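(* Let $m$ be a positive integer with $4\mid m$. Then there exist two distinct sets $A, B\subseteq \mathbb{Z}_{m}$ with $A\cup B=\mathbb{Z}_{m}$, $B\neq A+\overline{\frac{m}{2}}$, and $|A\cap B|=4$ or $|A\cap B|=m-4$, such that $R_{A}(\overline{n})=R_{B}(\overline{n})$ for all $\overline{n}\in \mathbb{Z}_{m}$.
   Context: $\mathbb{Z}_m$ denotes the set (group) of residue classes modulo $m$. For $A\subseteq\mathbb{Z}_m$ and $\overline{n}\in\mathbb{Z}_m$, $R_A(\overline{n})$ is the number of ordered pairs $(\overline{a},\overline{a'})\in A\times A$ with $\overline{a}+\overline{a'}=\overline{n}$. For $\overline{c}\in\mathbb{Z}_m$, $A+\overline{c}=\{\overline{a}+\overline{c}:\overline{a}\in A\}$. *)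

(* Defs.v *)
From HB Require Import structures.
From mathcomp Require Import all_boot all_order all_algebra.
Set Implicit Arguments.
Unset Strict Implicit.
Unset Printing Implicit Defensive.
Import GRing.Theory.
Local Open Scope ring_scope.

Definition repr_count (G : finZmodType) (A : {set G}) (n : G) : nat :=
  #|[set p in setX A A | p.1 + p.2 == n]|.

Definition translate (G : finZmodType) (A : {set G}) (c : G) : {set G} :=
  [set a + c | a in A].

(* Main.v *)
Require Import Defs.
From mathcomp Require Import all_boot all_order all_algebra.
From mathcomp Require Import zify.
Set Implicit Arguments.
Unset Strict Implicit.
Unset Printing Implicit Defensive.
Import GRing.Theory.
Local Open Scope ring_scope.

(** With q = m/4, take B to be the complement of {0, 2q} and A the complement
    of {q, 3q}, so that the intersection misses exactly the four multiples of q.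
    As 2q = -2q, both A + q and A - q equal B, hence (a, a') |-> (a + q, a' - q)
    is a sum-preserving bijection from A x A to B x B. *)

Lemma mem_translate (G : finZmodType) (A : {set G}) (c x : G) :
  (x \in translate A c) = (x - c \in A).
Proof.
apply/imsetP/idP => [[a aA ->]|xA]; first by rewrite addrK.
by exists (x - c); rewrite ?subrK.
Qed.

Lemma repr_count_translate (G : finZmodType) (A : {set G}) (c n : G) :
  translate A c = translate A (- c) ->
  repr_count A n = repr_count (translate A c) n.
Proof.
move=> eqAc; pose f (p : G * G) := (p.1 + c, p.2 - c).
have f_inj : injective f by case=> a b [a' b'] [/addIr -> /addIr ->].
rewrite /repr_count -(card_imset _ f_inj); apply: eq_card => -[x y].
(* [eqAc] is applied to [y] only: [x] is tested in [A + c] and [y] in [A - c], matching the opposite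
   shifts in [f]. *)
rewrite !inE /= mem_translate eqAc mem_translate opprK.
apply/imsetP/idP => [[[a b]]|/andP[/andP[xA yA] /eqP <-]].
  rewrite !inE /= => /andP[/andP[aA bA] /eqP <-] [-> ->].
  by rewrite addrK subrK aA bA addrACA subrr addr0 eqxx.
exists (x - c, y + c); last by rewrite /f /= subrK addrK.
by rewrite !inE /= xA yA addrACA addNr addr0 eqxx.
Qed.

(* 'Z_m is the ring of residues mod m as soon as 1 < m, which holds here. *)
Theorem theorem1p2 (m : nat) (m_gt0 : (0 < m)%N) (dvd4m : (4 %| m)%N) :
  exists A B : {set 'Z_m},
    [/\ A <> B,
        A :|: B = [set: 'Z_m],
        B <> translate A (m %/ 2)%:R,
        #|A :&: B| = 4%N \/ #|A :&: B| = (m - 4)%N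
      & forall n : 'Z_m, repr_count A n = repr_count B n].
Proof.
have m_gt1 : (1 < m)%N by lia.
have card_Zm : #|'Z_m| = m by rewrite card_ord Zp_cast.
pose q : 'Z_m := (m %/ 4)%:R.
have q2 : (m %/ 2)%:R = q *+ 2 by rewrite -mulrnA; congr _%:R; lia.
have q4 : q *+ 4 = 0 by rewrite -mulrnA divnK // pchar_Zp.
(* For [i < 4], [m %/ 4 * i] is below [m], hence its own residue. *)
have q_eq i j : (i < 4)%N -> (j < 4)%N -> (q *+ i == q *+ j) = (i == j).
  move=> i_lt j_lt; apply/eqP/eqP => [|-> //].
  rewrite -!mulrnA => /(congr1 val).
  by rewrite /= !val_Zp_nat // !modn_small; nia.
(* Even [0] and [q] are written as multiples of [q], so that [q_eq] settles each comparison. *)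
pose A := ~: [set q *+ 1; q *+ 3]; pose B := ~: [set q *+ 0; q *+ 2].
have BE : B = translate A q.
  apply/setP => x; rewrite mem_translate !inE !subr_eq -!mulrSr q4 mulr0n.
  by rewrite orbC.
have BEN : B = translate A (- q).
  apply/setP => x; rewrite mem_translate !inE opprK.
  by rewrite [q *+ 1]mulrSr [q *+ 3]mulrSr !(inj_eq (addIr q)).
have A0 : 0 \in A by rewrite -(mulr0n q) !inE !q_eq.
have B0 : 0 \notin B by rewrite !inE mulr0n eqxx.
exists A, B; split.
- by move=> eqAB; rewrite -eqAB A0 in B0.
- rewrite -setCI; apply/setP => x; rewrite !inE.
  by apply/negP => /andP[/orP[]/eqP->]; rewrite !q_eq.
(* The point [0] separates the two sets: it is missing from [B], while [0 - 2q = 4q - 2q = 2q] lies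
   in [A]. *)
- move=> eqB; move: B0; rewrite eqB mem_translate q2 -[0]q4 -mulrnBr //.
  by rewrite !inE !q_eq.
- right; rewrite -setCU cardsCs setCK card_Zm; congr (_ - _)%N.
  by rewrite -!setUA !cardsU1 cards1 !inE !q_eq.
- by move=> n; rewrite BE; apply: repr_count_translate; rewrite -BE.
Qed.
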